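(* For every $0 < \alpha < 1$ there exist $\xi > 0$ and $n_0, t_0 \in \mathbb{N}$ such that the following holds. Suppose $G$ is an $(\alpha, t)$-expander with $n \ge n_0$ vertices, for some $t \ge t_0$. Then $G$ is $m$-minor-universal for $$m = \xi n \frac{\log t}{\log n}.$$
   Context: A graph $G$ with $n$ vertices is an $(\alpha,t)$-expander (for $t \ge 1$, $0<\alpha<1$) if every $X \subseteq V(G)$ with $|X| \le \alpha n/t$ satisfies $|N(X)| \ge t|X|$, where $N(X) = \{v \in V(G)\setminus X : \{v,x\}\in E(G) \text{ for some } x \in X\}$. A graph $H$ is a minor of $G$ if there are disjoint sets $\{W_h \subseteq V(G)\}_{h\in V(H)}$, each inducing a connected subgraph of $G$, with an edge of $G$ between $W_h$ and $W_{h'}$ for every $\{h,h'\}\in E(H)$. A graph $G$ is $m$-minor-universal if it contains every graph with at most $m$ vertices and at most $m$ edges as a minor.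
   Formalization: The formal theorem additionally assumes t ≤ αn; for t > αn the expansion condition concerns only the empty set, so every graph is an (α,t)-expander and an edgeless graph with t = n (where m = ξn ≥ 2 for large n) is a counterexample. *)

(* Defs.v *)
From HB Require Import structures.
From mathcomp Require Import all_boot all_order all_algebra.
From mathcomp Require Import reals exp.

Set Implicit Arguments.
Unset Strict Implicit.
Unset Printing Implicit Defensive.

Import Order.TTheory GRing.Theory Num.Theory.
Local Open Scope ring_scope.

Record sgraph := SGraph {
  vertex :> finType;
  adj : rel vertex;
  adj_sym : symmetric adj;
  adj_irr : irreflexive adj
}.

Definition edges (G : sgraph) : {set {set G}} :=
  [set [set p.1; p.2] | p : G * G & adj p.1 p.2].

Definition nbhd (G : sgraph) (X : {set G}) : {set G} :=
  [set v | (v \notin X) && [exists x in X, adj v x]].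

Definition expander (R : realType) (alpha t : R) (G : sgraph) : Prop :=
  [/\ 0 < alpha < 1, 1 <= t &
      forall X : {set G}, #|X|%:R <= alpha * #|G|%:R / t ->
        t * #|X|%:R <= #|nbhd X|%:R].

Definition induced_adj (G : sgraph) (W : {set G}) : rel G :=
  [rel x y | [&& x \in W, y \in W & adj x y]].

(* A connected graph is nonempty; otherwise empty branch sets could
   represent isolated vertices in [is_minor]. *)
Definition induces_connected (G : sgraph) (W : {set G}) : Prop :=
  W != set0 /\ {in W &, forall x y, connect (induced_adj W) x y}.

Definition is_minor (H G : sgraph) : Prop :=
  exists W : H -> {set G},
    [/\ forall h h' : H, h != h' -> [disjoint W h & W h'],
        forall h : H, induces_connected (W h) &
        forall h h' : H, adj h h' ->
          exists x y : G, [/\ x \in W h, y \in W h' & adj x y]].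

(* The bound m is a real number, so that no rounding is imposed. *)
Definition minor_universal (R : realType) (m : R) (G : sgraph) : Prop :=
  forall H : sgraph, #|H|%:R <= m -> #|edges H|%:R <= m -> is_minor H G.

(* Main.v *)
(* Proof idea. Choose S with |S| >= alpha n / 8 minimising |N(S)| + eta |S|; then S has
   a small boundary and no sparse cuts. Build the minor inside S one vertex at a time,
   keeping a set B of discarded vertices with few neighbours among the unused vertices
   of S, so that B is tiny. When B is maximal, the unused part A of S still expands: balls
   grow by a factor t/2 up to linear size and then by a linear amount per step, so A has
   diameter O(log n / log t). To embed a vertex h of H, join a root in A to a neighbour
   of each branch set adjacent to h by short paths; their union, which need not be
   a disjoint union, has size O((1 + deg h) log n / log t), so all branch sets together
   have size O(m log n / log t), a small multiple of n. A branch set with no neighbour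
   left in A is moved into B, which can only happen finitely often. *)
Require Import Defs.
From mathcomp Require Import all_boot all_order all_algebra.
From mathcomp Require Import reals exp.
From mathcomp Require Import zify lra.
Import Order.TTheory GRing.Theory Num.Theory.
Local Open Scope ring_scope.

Set Implicit Arguments.
Unset Strict Implicit.
Unset Printing Implicit Defensive.

(** * Neighbourhoods and connected vertex sets *)

Lemma in_nbhd (G : sgraph) (X : {set G}) v :
  (v \in nbhd X) = (v \notin X) && [exists x in X, adj v x].
Proof. by rewrite inE. Qed.

Lemma nbhdP (G : sgraph) (X : {set G}) v :
  reflect (v \notin X /\ exists2 x, x \in X & adj v x) (v \in nbhd X).
Proof.
rewrite in_nbhd; apply: (iffP andP) => -[nXv].
  by case/exists_inP=> x Xx vx; split=> //; exists x.
by case=> x Xx vx; split=> //; apply/exists_inP; exists x.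
Qed.

Lemma nbhd_sub (G : sgraph) (X Y : {set G}) :
  X \subset Y -> nbhd X \subset Y :|: nbhd Y.
Proof.
move=> /subsetP sXY; apply/subsetP=> v /nbhdP[_ [x Xx vx]].
rewrite inE; have [//|nYv] := boolP (v \in Y).
by apply/nbhdP; split=> //; exists x; first exact: sXY.
Qed.

Lemma nbhdU_sub (G : sgraph) (X Y : {set G}) :
  nbhd (X :|: Y) \subset nbhd X :|: nbhd Y.
Proof.
apply/subsetP=> v /nbhdP[]; rewrite !inE negb_or => /andP[-> ->].
case=> x; rewrite inE => /orP[] h vx; apply/orP; [left|right];
  by apply/exists_inP; exists x.
Qed.

Lemma connect_induced_sub (G : sgraph) (P Q : {set G}) x y :
  P \subset Q -> connect (induced_adj P) x y -> connect (induced_adj Q) x y.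
Proof.
move=> /subsetP sPQ; apply: connect_sub => u v /and3P[Pu Pv uv].
by apply: connect1; rewrite /induced_adj /= !sPQ.
Qed.

Lemma induced_adj_sym (G : sgraph) (P : {set G}) : connect_sym (induced_adj P).
Proof.
apply: sym_connect_sym => x y; rewrite /induced_adj /= adj_sym.
by rewrite andbCA.
Qed.

Lemma induces_connectedP (G : sgraph) (P : {set G}) r :
  r \in P -> (forall x, x \in P -> connect (induced_adj P) r x) ->
  induces_connected P.
Proof.
move=> Pr cP; split; first by apply/set0Pn; exists r.
move=> x y Px Py; apply: connect_trans (cP y Py).
by rewrite induced_adj_sym cP.
Qed.

Lemma induces_connected1 (G : sgraph) (x : G) : induces_connected [set x].
Proof.
by apply: (@induces_connectedP _ _ x) => [|y]; rewrite inE // => /eqP->.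
Qed.

Lemma induces_connectedU (G : sgraph) (P Q : {set G}) z :
  induces_connected P -> induces_connected Q -> z \in P -> z \in Q ->
  induces_connected (P :|: Q).
Proof.
move=> [_ cP] [_ cQ] Pz Qz; apply: (@induces_connectedP _ _ z).
  by rewrite inE Pz.
move=> x; rewrite inE => /orP[Px|Qx].
  by apply: (connect_induced_sub (subsetUl _ _)); apply: cP.
by apply: (connect_induced_sub (subsetUr _ _)); apply: cQ.
Qed.

Lemma induces_connected_add (G : sgraph) (P : {set G}) x y :
  induces_connected P -> x \in P -> adj y x -> induces_connected (y |: P).
Proof.
move=> cP Px yx; have -> : y |: P = [set y; x] :|: P.
  by apply/setP=> z; rewrite !inE; case: eqP => //= _; case: eqP => // ->.
apply: (@induces_connectedU _ _ _ x) => //; last by rewrite !inE eqxx orbT.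
apply: (@induces_connectedP _ _ y); first by rewrite !inE eqxx.
move=> z; rewrite !inE => /orP[]/eqP-> //.
by apply: connect1; rewrite /induced_adj /= !inE !eqxx orbT.
Qed.

(** The root [r] is added separately so that the set stays nonempty when [D] is empty, as happens
    for a vertex with no embedded neighbour. *)
Lemma induces_connected_bigcup (G : sgraph) (I : finType) (D : {set I})
    (P : I -> {set G}) r :
  (forall i, i \in D -> induces_connected (P i) /\ r \in P i) ->
  induces_connected (r |: \bigcup_(i in D) P i).
Proof.
move=> cP; apply: (@induces_connectedP _ _ r); first by rewrite !inE eqxx.
move=> x; rewrite !inE => /orP[/eqP-> //|/bigcupP[i Di Pix]].
have [[_ cPi] Pir] := cP i Di.
apply: (@connect_induced_sub _ (P i)); last exact: cPi.
by apply: subsetU; rewrite bigcup_sup ?orbT.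
Qed.

(** * Balls *)

Definition ball (G : sgraph) (A : {set G}) (x : G) (j : nat) : {set G} :=
  iter j (fun X => X :|: nbhd X :&: A) [set x].

Lemma ball_sub (G : sgraph) (A : {set G}) x j : x \in A -> ball A x j \subset A.
Proof.
move=> Ax; elim: j => [|j IH] /=; first by rewrite sub1set.
by rewrite subUset IH subsetIr.
Qed.

Lemma ball_center (G : sgraph) (A : {set G}) x j : x \in ball A x j.
Proof. by elim: j => [|j IH] /=; rewrite !inE // IH. Qed.

Lemma ball_connected (G : sgraph) (A : {set G}) x j y : x \in A -> y \in ball A x j ->
  exists P : {set G},
    [/\ induces_connected P, P \subset A, x \in P, y \in P & (#|P| <= j.+1)%N].
Proof.
move=> Ax; elim: j y => [|j IH] y /=.
  rewrite inE => /eqP->; exists [set x].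
  by rewrite sub1set Ax inE cards1; split=> //; apply: induces_connected1.
rewrite inE => /orP[/IH[P [cP sPA Px Py leP]]|]; first by exists P; split=> //; lia.
rewrite inE => /andP[/nbhdP[_ [z /IH[P [cP sPA Px Pz leP]] yz] Ay]].
exists (y |: P); split; rewrite ?inE ?eqxx ?Px ?orbT //.
- exact: induces_connected_add cP Pz yz.
- by rewrite subUset sub1set Ay.
- by rewrite cardsU1; case: (y \in P) => /=; lia.
Qed.

(** Two subsets of [S], each with more than half of its elements, must meet; paths from both centres
    to a common vertex are glued there. *)
Lemma ball_join (G : sgraph) (A S : {set G}) x y j :
  A \subset S -> x \in A -> y \in A ->
  (#|S| < #|ball A x j|.*2)%N -> (#|S| < #|ball A y j|.*2)%N ->
  exists P : {set G}, [/\ induces_connected P, P \subset A, x \in P, y \in P &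
    (#|P| <= j.+1.*2)%N].
Proof.
move=> sAS Ax Ay bx by_.
have /set0Pn[z] : ball A x j :&: ball A y j != set0.
  rewrite -card_gt0.
  have : (#|ball A x j :|: ball A y j| <= #|S|)%N.
    by apply/subset_leq_card/(subset_trans _ sAS); rewrite subUset !ball_sub.
  have := cardsUI (ball A x j) (ball A y j); lia.
rewrite inE => /andP[/(ball_connected Ax)[P [cP sP Px Pz leP]]].
move=> /(ball_connected Ay)[Q [cQ sQ Qy Qz leQ]].
exists (P :|: Q); split; rewrite ?inE ?Px ?Qy ?orbT //.
- exact: induces_connectedU cP cQ Pz Qz.
- by rewrite subUset sP.
- have := cardsUI P Q; lia.
Qed.

(** * Sizes of unions and the degree sum *)

Lemma leq_card_bigcup (T I : finType) (D : pred I) (P : I -> {set T}) :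
  (#|\bigcup_(i | D i) P i| <= \sum_(i | D i) #|P i|)%N.
Proof.
apply: (big_ind2 (fun (X : {set T}) n => #|X| <= n)%N) => [|X m Y n leX leY|//].
  by rewrite cards0.
exact: leq_trans (leq_card_setU _ _) (leq_add leX leY).
Qed.

Lemma card_bigcup_le (T I : finType) (D : {set I}) (P : I -> {set T}) l :
  (forall i, i \in D -> #|P i| <= l)%N -> (#|\bigcup_(i in D) P i| <= #|D| * l)%N.
Proof.
move=> leP; apply: leq_trans (leq_card_bigcup _ _) _.
by rewrite -sum_nat_const; apply: leq_sum.
Qed.

Lemma sum_degree_le (H : sgraph) :
  (\sum_(h : H) #|[set h' | adj h h']| <= #|edges H|.*2)%N.
Proof.
have -> : (\sum_(h : H) #|[set h' | adj h h']| = #|[set p : H * H | adj p.1 p.2]|)%N.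
  rewrite -sum1_card (eq_bigr (fun h => \sum_(h' | adj h h') 1)%N) => [|h _].
    by rewrite pair_big_dep; apply: eq_bigl => p; rewrite inE.
  by rewrite -sum1_card; apply: eq_bigl => p; rewrite inE.
(* Ordered adjacent pairs are grouped by the edge they span; an edge comes from at most two of
   them. *)
pose f (p : H * H) := [set p.1; p.2].
rewrite -sum1_card (partition_big f (mem (edges H))) /=; last first.
  by move=> p; rewrite inE => hp; apply/imsetP; exists p; rewrite // inE.
rewrite -muln2 -sum_nat_const; apply: leq_sum => e /imsetP[[u v] _ ->].
rewrite sum1_card; apply: (@leq_trans #|[set (u, v); (v, u)]|); last first.
  by rewrite cards2; case: (_ != _).
apply/subset_leq_card/subsetP=> -[a b] /andP[]; rewrite inE => hab /eqP/setP eab.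
rewrite !inE !xpair_eqE.
have nab : a != b by apply: contraTneq hab => ->; rewrite /= adj_irr.
have := eab b; have := eab a; rewrite !inE !eqxx orbT /=.
move=> /esym/orP[]/eqP ea /esym/orP[]/eqP eb;
  by move: nab; rewrite ea eb ?eqxx ?orbT.
Qed.

(** * Growing a partial model *)

(* In a barrier for the used set [U], the discarded set [B] has at most [c] times as many
   outside neighbours in the host [S] as elements; if [S] expands by more than [c],
   only a large [U] can cause this, so [B] stays small. *)
Definition barrier (R : numDomainType) (G : sgraph) (S U : {set G}) (k : nat) (c : R)
    (B : {set G}) : Prop :=
  [/\ B \subset S :\: U, (#|B| <= k)%N &
      #|nbhd B :&: (S :\: U)|%:R <= c * #|B|%:R].

(** Maximality is phrased as the failure of the hypothesis of [barrierU] for every nonempty [X] that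
    still fits under [k]. It thus directly says that such sets expand by more than [c] in what
    remains. *)
Definition maximal_barrier (R : numDomainType) (G : sgraph) (S U : {set G}) (k : nat)
    (c : R) (B : {set G}) : Prop :=
  barrier S U k c B /\
  forall X : {set G}, X \subset S :\: U :\: B -> X != set0 ->
    (#|B| + #|X| <= k)%N -> c * #|X|%:R < #|nbhd X :&: (S :\: U :\: B)|%:R.

Definition cover_of (H G : sgraph) (W : H -> {set G}) : {set G} := \bigcup_h W h.

(** An empty branch set marks a vertex not yet embedded. The size bound allows one root plus one
    path of at most [l] vertices per neighbour in [H]. *)
Definition partial_model (H G : sgraph) (S : {set G}) (l : nat) (W : H -> {set G}) : Prop :=
  [/\ forall h h' : H, h != h' -> [disjoint W h & W h'],
      forall h, W h != set0 -> induces_connected (W h),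
      forall h h' : H, adj h h' -> W h != set0 -> W h' != set0 ->
        exists x y : G, [/\ x \in W h, y \in W h' & adj x y],
      forall h, (#|W h| <= 1 + #|[set h' | adj h h']| * l)%N &
      forall h, W h \subset S].

Lemma card_cover_of (H G : sgraph) (S : {set G}) l (W : H -> {set G}) :
  partial_model S l W -> (#|cover_of W| <= #|H| + #|edges H|.*2 * l)%N.
Proof.
case=> _ _ _ leW _; apply: leq_trans (leq_card_bigcup _ _) _.
apply: (@leq_trans (\sum_(h : H) (1 + #|[set h' | adj h h']| * l))); first exact: leq_sum.
rewrite big_split /= sum1_card leq_add2l -big_distrl /= leq_mul2r.
by rewrite sum_degree_le orbT.
Qed.

Lemma cover_of_sub (H G : sgraph) (S : {set G}) l (W : H -> {set G}) :
  partial_model S l W -> cover_of W \subset S.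
Proof. by case=> _ _ _ _ sW; apply/bigcupsP => h _. Qed.

(** An outside neighbour of the union is either one of [B] or a neighbour of [X] outside [B], so the
    two boundary bounds add up. *)
Lemma barrierU (R : numDomainType) (G : sgraph) (S U : {set G}) k (c : R) (B X : {set G}) :
  barrier S U k c B -> X \subset S :\: U :\: B -> (#|B| + #|X| <= k)%N ->
  #|nbhd X :&: (S :\: U :\: B)|%:R <= c * #|X|%:R ->
  barrier S U k c (B :|: X).
Proof.
move=> [sB _ leB] sX leBX leX.
have dBX : [disjoint B & X].
  rewrite -setI_eq0 -subset0; apply/subsetP=> x; rewrite inE => /andP[Bx].
  by move=> /(subsetP sX); rewrite !inE Bx.
have cBX : #|B :|: X| = (#|B| + #|X|)%N.
  by have := leq_card_setU B X; rewrite dBX => -[_ /eqP].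
split; last 1 first.
- have : (#|nbhd (B :|: X) :&: (S :\: U)| <=
          #|nbhd B :&: (S :\: U)| + #|nbhd X :&: (S :\: U :\: B)|)%N.
    apply: leq_trans (leq_card_setU _ _); apply/subset_leq_card/subsetP=> v.
    rewrite inE => /andP[Nv Sv]; have := subsetP (nbhdU_sub B X) v Nv.
    have /andP[nv _] : (v \notin B :|: X) && true by case/nbhdP: Nv => ->.
    move: nv Sv; rewrite !inE negb_or => /andP[-> ->] /= ->.
    by rewrite !andbT.
  rewrite -(ler_nat R) natrD cBX natrD mulrDr => le; apply: le_trans le _.
  exact: lerD.
- by rewrite subUset sB (subset_trans sX) // subsetDl.
- by rewrite cBX.
Qed.

Lemma barrier_sub (R : numDomainType) (G : sgraph) (S U U' : {set G}) k (c : R)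
    (B : {set G}) :
  U \subset U' -> [disjoint B & U'] -> barrier S U k c B -> barrier S U' k c B.
Proof.
move=> sU dB [sB kB leB]; split=> //.
  by rewrite subsetD dB andbT (subset_trans sB) ?subsetDl.
apply: le_trans leB; rewrite ler_nat; apply/subset_leq_card/setIS.
exact: setDS.
Qed.

(** All neighbours of [W] in [S] lie in [U] or [B], so moving [W] from the used set into the barrier
    creates no new boundary, while the allowed boundary does not shrink. *)
Lemma barrier_release (R : numDomainType) (G : sgraph) (S U : {set G}) k (c : R)
    (B W : {set G}) :
  0 <= c -> W \subset U -> U \subset S -> (#|B| + #|W| <= k)%N ->
  nbhd W :&: (S :\: U :\: B) = set0 -> barrier S U k c B ->
  barrier S (U :\: W) k c (B :|: W).
Proof.
move=> c0 sWU sUS leBW NW0 [sB kB leB].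
have le : (#|nbhd (B :|: W) :&: (S :\: (U :\: W))| <= #|nbhd B :&: (S :\: U)|)%N.
  apply/subset_leq_card/subsetP=> v; rewrite inE => /andP[Nv Sv].
  have := subsetP (nbhdU_sub B W) v Nv.
  have nv : v \notin B :|: W by case/nbhdP: Nv.
  have := in_set0 v; rewrite -NW0; move: nv Sv; rewrite !inE.
  by case: (v \in B); case: (v \in W); case: (v \in U); case: (v \in S);
     rewrite //= ?andbT ?orbF // => _ _ ->; rewrite orbF.
split.
- apply/subsetP=> v; rewrite !inE => /orP[/(subsetP sB)|Wv].
    by rewrite !inE => /andP[/negbTE-> ->]; rewrite andbF.
  by rewrite Wv /= (subsetP sUS) ?(subsetP sWU).
- exact: leq_trans (leq_card_setU _ _) leBW.
- apply: le_trans (_ : _ <= c * #|B|%:R) _; last first.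
    by rewrite ler_wpM2l // ler_nat subset_leq_card // subsetUl.
  by apply: le_trans leB; rewrite ler_nat.
Qed.

Definition update (I : eqType) (T : Type) (W : I -> T) i x : I -> T :=
  fun j => if j == i then x else W j.

Lemma cover_of_update0 (H G : sgraph) (S : {set G}) l (W : H -> {set G}) h :
  partial_model S l W -> cover_of (update W h set0) = cover_of W :\: W h.
Proof.
case=> dW _ _ _ _; apply/setP=> v; rewrite inE; apply/bigcupP/andP.
  case=> h' _; rewrite /update; case: eqP => [_|/eqP nh]; first by rewrite inE.
  move=> Wv; split; last by apply/bigcupP; exists h'.
  by rewrite (disjointFr (dW _ _ nh) Wv).
case=> nWv /bigcupP[h' _ Wv]; exists h' => //; rewrite /update.
by case: eqP => // e; rewrite -e Wv in nWv.
Qed.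

Lemma partial_model_update0 (H G : sgraph) (S : {set G}) l (W : H -> {set G}) h :
  partial_model S l W -> partial_model S l (update W h set0).
Proof.
case=> dW cW aW lW sW; split.
- move=> h1 h2 n12; rewrite /update.
  case: (h1 =P h) => _; first by rewrite -setI_eq0 set0I.
  case: (h2 =P h) => _; first by rewrite -setI_eq0 setI0.
  exact: dW.
- by move=> h'; rewrite /update; case: (h' =P h) => _; [rewrite eqxx | apply: cW].
- move=> h1 h2 a12; rewrite /update.
  case: (h1 =P h) => _; first by rewrite eqxx.
  by case: (h2 =P h) => _; [rewrite eqxx | apply: aW].
- by move=> h'; rewrite /update; case: (h' =P h) => _; rewrite ?cards0.
- by move=> h'; rewrite /update; case: (h' =P h) => _; rewrite ?sub0set.
Qed.

Lemma partial_model_update (H G : sgraph) (S P : {set G}) l (W : H -> {set G}) h :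
  partial_model S l W -> P \subset S :\: cover_of W -> induces_connected P ->
  (#|P| <= 1 + #|[set h' | adj h h']| * l)%N ->
  (forall h', adj h h' -> W h' != set0 ->
     exists x y, [/\ x \in P, y \in W h' & adj x y]) ->
  partial_model S l (update W h P).
Proof.
case=> dW cW aW lW sW; rewrite subsetD => /andP[sP dP] cP lP aP.
have dPW h' : [disjoint P & W h'] by apply: disjointWr dP; apply: bigcup_sup.
split.
- move=> h1 h2 n12; rewrite /update.
  case: (h1 =P h) => [e1|_]; case: (h2 =P h) => [e2|_]; last exact: dW.
  + by rewrite e1 e2 eqxx in n12.
  + exact: dPW.
  + by rewrite disjoint_sym dPW.
- by move=> h'; rewrite /update; case: (h' =P h) => // _; apply: cW.
- move=> h1 h2 a12; rewrite /update.
  case: (h1 =P h) => [e1|_]; case: (h2 =P h) => [e2|_].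
  + by rewrite e1 e2 adj_irr in a12.
  + by move=> _; apply: aP; rewrite -e1.
  + move=> W1 _; have [|x [y [Px Wy xy]]] := aP h1 _ W1; first by rewrite -e2 adj_sym.
    by exists y, x; rewrite adj_sym.
  + exact: aW.
- by move=> h'; rewrite /update; case: (h' =P h) => // ->.
- by move=> h'; rewrite /update; case: (h' =P h).
Qed.

(** The new branch set is the union of routes from the root [r], one to a neighbour of each embedded
    branch set that [h] must touch. Sharing [r] makes it connected, and overlaps of routes only
    reduce its size. *)
Lemma partial_model_extend (H G : sgraph) (S A : {set G}) l (W : H -> {set G}) h r :
  partial_model S l W -> A \subset S :\: cover_of W -> r \in A ->
  {in A &, forall x y, exists P : {set G},
     [/\ induces_connected P, P \subset A, x \in P, y \in P & (#|P| <= l)%N]} ->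
  (forall h', W h' != set0 -> nbhd (W h') :&: A != set0) ->
  exists2 P : {set G}, P \subset A /\ P != set0 & partial_model S l (update W h P).
Proof.
move=> pW sA Ar route reach.
pose D := [set h' | adj h h' & W h' != set0].
have /fin_all_exists[P hP] h' : exists P : {set G}, h' \in D ->
    [/\ induces_connected P, P \subset A, r \in P, (#|P| <= l)%N &
        exists x y, [/\ x \in P, y \in W h' & adj x y]].
  have [/[!inE]/andP[ah /reach/set0Pn[v]]|] := boolP (h' \in D); last by exists set0.
  rewrite inE => /andP[/nbhdP[_ [y Wy vy]] Av].
  have [P [cP sP Pr Pv lP]] := route r v Ar Av.
  by exists P => _; split=> //; exists v, y.
have sQ : r |: \bigcup_(i in D) P i \subset A.
  rewrite subUset sub1set Ar; apply/bigcupsP=> i /hP[] //.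
exists (r |: \bigcup_(i in D) P i).
  by split=> //; apply/set0Pn; exists r; rewrite !inE eqxx.
apply: partial_model_update => //.
- exact: subset_trans sQ sA.
- by apply: induces_connected_bigcup => i /hP[].
- rewrite cardsU1; apply: leq_add; first by case: (_ \in _).
  apply: leq_trans (_ : #|D| * l <= _)%N; last first.
    rewrite leq_mul2r subset_leq_card ?orbT //.
    by apply/subsetP=> i; rewrite !inE => /andP[].
  by apply: card_bigcup_le => i /hP[].
- move=> h' ah Wh'; have Dh' : h' \in D by rewrite inE ah.
  have [_ _ _ _ [x [y [Px Wy xy]]]] := hP h' Dh'.
  exists x, y; split=> //; rewrite !inE; apply/orP; right.
  by apply/bigcupP; exists h'.
Qed.

Lemma card_support_update (H G : sgraph) (W : H -> {set G}) h (P : {set G}) :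
  W h = set0 -> P != set0 ->
  #|[set h' | update W h P h' != set0]| = #|[set h' | W h' != set0]|.+1.
Proof.
move=> Wh0 P0; have -> : [set h' | update W h P h' != set0] = h |: [set h' | W h' != set0].
  by apply/setP=> h'; rewrite !inE /update; case: (h' =P h).
by rewrite cardsU1 inE Wh0 eqxx.
Qed.

(* Releasing a blocked branch set into the barrier undoes part of the embedding, but
   enlarges the barrier: hence the lexicographic potential (|B|, embedded vertices). *)
Lemma minor_of_core (R : realDomainType) (G H : sgraph) (S : {set G}) (k l : nat) (c : R) :
  0 <= c ->
  (forall U B : {set G}, U \subset S -> (#|U| <= #|H| + #|edges H|.*2 * l)%N ->
     maximal_barrier S U k c B -> S :\: U :\: B != set0 /\
     {in S :\: U :\: B &, forall x y, exists P : {set G},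
       [/\ induces_connected P, P \subset S :\: U :\: B, x \in P, y \in P &
           (#|P| <= l)%N]}) ->
  (forall U B W : {set G}, U \subset S -> (#|U| <= #|H| + #|edges H|.*2 * l)%N ->
     barrier S U k c B -> W \subset U -> (k < #|B| + #|W|)%N ->
     nbhd W :&: (S :\: U :\: B) != set0) ->
  is_minor H G.
Proof.
move=> c0 route big.
(* The weight [#|H|.+1] exceeds any number of embedded vertices, so one more barrier vertex
   outweighs the loss of every branch set. *)
pose pot (B : {set G}) (W : H -> {set G}) :=
  (#|B| * #|H|.+1 + #|[set h | W h != set0]|)%N.
have potP (B B' : {set G}) W W' : (#|B| < #|B'|)%N -> (pot B W < pot B' W')%N.
  move=> lt; rewrite /pot; have := max_card (mem [set h | W h != set0]).
  rewrite -ltnS => ltW; apply: leq_trans (_ : #|B|.+1 * #|H|.+1 <= _)%N.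
    by rewrite mulSn addnC ltn_add2r.
  by apply: leq_trans (leq_addr _ _); rewrite leq_mul2r lt orbT.
suff main n (B : {set G}) W : (#|G|.+1 * #|H|.+1 - pot B W < n)%N -> partial_model S l W ->
    barrier S (cover_of W) k c B -> is_minor H G.
  pose W0 (h : H) : {set G} := set0.
  apply: (main _ set0 W0 (ltnSn _)).
    rewrite /W0; split=> [h h' _|h|h h' _|h|h]; rewrite ?eqxx ?cards0 ?sub0set //.
    by rewrite -setI_eq0 set0I.
  split; rewrite ?sub0set ?cards0 // mulr0 lern0 cards_eq0 -subset0.
  by apply/subsetP=> v; rewrite inE => /andP[/nbhdP[_ [x]]]; rewrite inE.
elim: n B W => // n IH B W; rewrite ltnS => ltn pW bW.
have step (B' : {set G}) W' : (pot B W < pot B' W')%N -> partial_model S l W' ->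
    barrier S (cover_of W') k c B' -> is_minor H G.
  move=> lt; apply: IH; apply: leq_trans ltn; apply: ltn_sub2l lt.
  have lB := max_card (mem B); rewrite /pot.
  have := max_card (mem [set h | W h != set0]); rewrite -ltnS => ltW.
  apply: leq_trans (_ : #|B|.+1 * #|H|.+1 <= _)%N.
    by rewrite mulSn addnC ltn_add2r.
  by rewrite leq_mul2r ltnS lB orbT.
set U := cover_of W in bW *; pose A := S :\: U :\: B.
have sUS : U \subset S := cover_of_sub pW.
have cU := card_cover_of pW; rewrite -/U in cU.
have [h Wh0|full] := pickP (fun h => W h == set0); last first.
  have nz h : W h != set0 by rewrite full.
  case: pW => dW cW aW _ _; exists W; split=> // [h|h h' a]; first exact: cW.
  exact: aW.
(* If some [X] expands too little, the barrier absorbs it. *)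
have [/existsP[X /and4P[sX X0 leBX small]]|nX] :=
  boolP [exists X : {set G}, [&& X \subset A, X != set0, (#|B| + #|X| <= k)%N &
    #|nbhd X :&: A|%:R <= c * #|X|%:R]].
  apply: (step (B :|: X) W) => //; last exact: barrierU.
  apply: potP; apply/proper_card/properP; split; first exact: subsetUl.
  have /set0Pn[x Xx] := X0; exists x; first by rewrite inE Xx orbT.
  by have := subsetP sX x Xx; rewrite !inE => /andP[].
have mB : maximal_barrier S U k c B.
  split=> // X sX X0 leBX; rewrite ltNge; apply: contra nX => small.
  by apply/existsP; exists X; apply/and4P.
(* A branch set cut off from [A] is released into the barrier; by [big] it fits under the capacity
   [k]. *)
have [/existsP[h' /andP[Wh' /eqP NW]]|nh] :=
  boolP [exists h', (W h' != set0) && (nbhd (W h') :&: A == set0)].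
  have sWU : W h' \subset U by apply: bigcup_sup.
  have leBW : (#|B| + #|W h'| <= k)%N.
    by rewrite leqNgt; apply/negP=> /(big _ _ _ sUS cU bW sWU)/negP[]; apply/eqP.
  apply: (step (B :|: W h') (update W h' set0)).
  - apply: potP; apply/proper_card/properP; split; first exact: subsetUl.
    have /set0Pn[x Wx] := Wh'; exists x; first by rewrite inE Wx orbT.
    apply/negP=> Bx; case: bW => /subsetP/(_ x Bx).
    by rewrite inE (subsetP sWU).
  - exact: partial_model_update0.
  - by rewrite (cover_of_update0 _ pW); apply: barrier_release.
have [/set0Pn[r Ar] rt] := route U B sUS cU mB.
have [||P [sP P0] pW'] := partial_model_extend h pW _ Ar rt.
- exact: subsetDl.
- move=> h' Wh'; apply: contra nh => NW.
  by apply/existsP; exists h'; rewrite Wh'.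
apply: (step B (update W h P)) => //.
  by rewrite /pot card_support_update ?addnS //; apply/eqP.
(* The new branch set lies in [A], hence avoids [B], so [B] remains a barrier for the larger used
   set. *)
apply: barrier_sub (bW).
  apply/bigcupsP=> h' _; apply/subsetP=> x Wx; apply/bigcupP; exists h' => //.
  by rewrite /update; case: eqP => // e; move: Wx; rewrite e (eqP Wh0) inE.
rewrite -setI_eq0 -subset0; apply/subsetP=> x; rewrite inE => /andP[Bx].
case/bigcupP=> h' _; rewrite /update; case: eqP => [_ /(subsetP sP)|_ Wx].
  by rewrite !inE Bx.
case: bW => /subsetP/(_ x Bx); rewrite inE => /andP[/negP[]].
by apply/bigcupP; exists h'.
Qed.

(** * Core of an expander *)

Lemma exists_subset_card (T : finType) (X : {set T}) m :
  (m <= #|X|)%N -> exists2 Y : {set T}, Y \subset X & #|Y| = m.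
Proof.
move=> lem; exists [set x in take m (enum X)].
  by apply/subsetP=> x; rewrite inE => /mem_take; rewrite mem_enum.
rewrite cardsE; have /card_uniqP-> : uniq (take m (enum X)) by rewrite take_uniq ?enum_uniq.
by rewrite size_takel // -cardE.
Qed.

(* Minimality of |N(S)| + eta |S| forbids sparse cuts inside S: passing to a part X of S
   saves eta (|S| - |X|), so it must create that much new boundary. *)
Lemma exists_core (R : realFieldType) (G : sgraph) (eta s : R) :
  0 <= eta -> s <= #|G|%:R ->
  exists S : {set G}, [/\ s <= #|S|%:R, #|nbhd S|%:R <= eta * #|G|%:R &
    forall X : {set G}, X \subset S -> s <= #|X|%:R -> (#|X|.*2 <= #|S|)%N ->
      eta * #|S|%:R <= 2 * #|nbhd X :&: S|%:R].
Proof.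
move=> eta0 leG; pose F (S : {set G}) : R := #|nbhd S|%:R + eta * #|S|%:R.
have sT : s <= #|[set: G]|%:R by rewrite cardsT.
case: (@Order.TotalTheory.arg_minP _ R _ setT (fun S : {set G} => s <= #|S|%:R) F sT).
move=> S leS minS; exists S; split=> // [|X sXS leX leXS].
  (* Comparing [S] with the whole vertex set, which has no outside neighbours, bounds its
     boundary. *)
  have N0 : nbhd [set: G] = set0 by apply/setP=> v; rewrite !inE.
  have := minS _ sT; rewrite /F N0 cards0 cardsT add0r.
  by apply: le_trans; rewrite lerDl mulr_ge0.
have := minS _ leX; rewrite /F => le1.
have le2 : (#|nbhd X| <= #|nbhd X :&: S| + #|nbhd S|)%N.
  apply: leq_trans (leq_card_setU _ _); apply/subset_leq_card/subsetP=> v Nv.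
  by have := subsetP (nbhd_sub sXS) v Nv; rewrite !in_setU in_setI Nv.
have : (2 * #|X|%:R <= #|S|%:R :> R) by rewrite -natrM ler_nat mul2n.
move: le2; rewrite -(ler_nat R) natrD => le2 le3.
have := ler_wpM2l eta0 le3; lra.
Qed.

(** Growth has two phases: [i] steps multiply the size by [c] until it reaches [s], then each of [j]
    steps adds [delta] unless half of [S] is already exceeded. Since [j] times [delta] is at least
    the size of [S], the second phase cannot stay below half. *)
Lemma ball_large (R : realFieldType) (G : sgraph) (S A : {set G}) (c s delta : R)
    (i j : nat) x :
  A \subset S -> x \in A -> 1 <= c -> s <= c ^+ i -> #|S|%:R <= j%:R * delta ->
  (forall X : {set G}, X \subset A -> X != set0 ->
     Num.min (c * #|X|%:R) s <= #|X :|: nbhd X :&: A|%:R) ->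
  (forall X : {set G}, X \subset A -> s <= #|X|%:R -> (#|X|.*2 <= #|S|)%N ->
     delta <= #|nbhd X :&: A|%:R) ->
  (#|S| < #|ball A x (i + j)|.*2)%N.
Proof.
move=> sAS Ax c1 leci leS small medium.
have bA m : ball A x m \subset A by apply: ball_sub.
have b0 m : ball A x m != set0 by apply/set0Pn; exists x; apply: ball_center.
have first m : Num.min (c ^+ m) s <= #|ball A x m|%:R.
  elim: m => [|m IH]; first by rewrite expr0 ge_min /= cards1 lexx.
  apply: le_trans (small _ (bA m) (b0 m)).
  have c0 : 0 <= c by apply: le_trans c1.
  rewrite le_min exprS ge_min; apply/andP; split; last by rewrite ge_min lexx orbT.
  move: IH; rewrite ge_min => /orP[/(ler_wpM2l c0)->//|le].
  apply/orP; right; apply: le_trans le _.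
  by rewrite ler_peMl.
have lei : s <= #|ball A x i|%:R.
  by apply: le_trans (first i); rewrite le_min leci lexx.
have grow m : (#|ball A x m.+1| = #|ball A x m| + #|nbhd (ball A x m) :&: A|)%N.
  have d0 : ball A x m :&: (nbhd (ball A x m) :&: A) = set0.
    apply/setP=> v; rewrite in_setI in_setI in_nbhd in_set0.
    by case: (v \in ball A x m).
  by rewrite /= cardsU d0 cards0 subn0.
have second m : s <= #|ball A x (i + m)|%:R /\
    ((#|S| < #|ball A x (i + m)|.*2)%N \/ m%:R * delta <= #|ball A x (i + m)|%:R).
  elim: m => [|m [les IH]]; first by rewrite addn0 mul0r; split=> //; right.
  rewrite addnS; have le1 : (#|ball A x (i + m)| <= #|ball A x (i + m).+1|)%N.
    by rewrite grow leq_addr.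
  split; first by apply: le_trans les _; rewrite ler_nat.
  case: (leqP #|ball A x (i + m)|.*2 #|S|) => [le2|]; last by left; lia.
  right; case: IH => [|IH]; first by lia.
  by rewrite grow natrD -natr1 mulrDl mul1r lerD ?medium.
have [_ [//|leb]] := second j.
have : (#|S| <= #|ball A x (i + j)|)%N by rewrite -(ler_nat R); apply: le_trans leb.
have : (0 < #|S|)%N by apply/card_gt0P; exists x; apply: (subsetP sAS).
lia.
Qed.

(* Here [k] is the integer part of [a n / t]; all constants are stated without
   denominators. *)
Record expander_core (R : realFieldType) (G : sgraph) (a t : R) (k : nat)
    (S : {set G}) : Prop := ExpanderCore {
  core_gt0 : 0 < a;
  core_lt1 : a < 1;
  core_n : 0 < #|G|%:R :> R;
  core_t : 256 <= a * t;
  core_k : k%:R * t <= a * #|G|%:R;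
  core_k2 : a * #|G|%:R <= 2 * (k%:R * t);
  core_expand : forall X : {set G}, (#|X| <= k)%N -> t * #|X|%:R <= #|nbhd X|%:R;
  core_large : a * #|G|%:R <= 8 * #|S|%:R;
  core_nbhd : 64 * #|nbhd S|%:R <= a * #|G|%:R;
  core_cut : forall X : {set G}, X \subset S -> a * #|G|%:R <= 8 * #|X|%:R ->
    (#|X|.*2 <= #|S|)%N -> a ^+ 2 * #|G|%:R <= 1024 * #|nbhd X :&: S|%:R
}.

(** * Expansion left in a core after removing a used set and a barrier *)

Section Core.

Variables (R : realFieldType) (G : sgraph) (a t : R) (k : nat) (S : {set G}).
Hypothesis cS : expander_core a t k S.
Variables (U B : {set G}).
Hypotheses (sUS : U \subset S) (leU : 4096 * #|U|%:R <= a ^+ 2 * #|G|%:R).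

Let n : R := #|G|%:R.
Let A := S :\: U :\: B.

Let an_gt0 : 0 < a * n.
Proof. by rewrite mulr_gt0 ?(core_gt0 cS) ?(core_n cS). Qed.

Let a2_le : a ^+ 2 * n <= a * n.
Proof.
have := core_lt1 cS; have := core_gt0 cS; have := core_n cS; rewrite -/n => n0 a0 a1.
by rewrite ler_wpM2r ?(ltW n0) // expr2 ler_piMl ?ltW.
Qed.

Let t_gt0 : 256 < t.
Proof.
have := core_lt1 cS; have := core_gt0 cS; have := core_t cS => le a0 a1.
have t0 : 0 < t by rewrite -(pmulr_rgt0 _ a0); lra.
have : a * t < t by rewrite gtr_pMl.
lra.
Qed.

Let k_le : 256 * k%:R <= a ^+ 2 * n.
Proof.
have := core_gt0 cS; have := core_k cS; have := core_t cS; rewrite -/n => le1 le2 a0.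
have := ler_wpM2l (ltW a0) le2; rewrite [X in _ <= X]mulrA -expr2; apply: le_trans.
by rewrite mulrCA mulrC ler_wpM2l.
Qed.

Let k_gt0 : (0 < k)%N.
Proof.
rewrite lt0n; apply: contraTneq (core_k2 cS) => ->.
by rewrite mul0r mulr0 -ltNge.
Qed.

Lemma card_core_split (N : {set G}) :
  (#|N :&: S| <= #|N :&: A| + (#|U| + #|B|))%N.
Proof.
apply: leq_trans (leq_add (leqnn _) (leq_card_setU U B)).
apply: leq_trans (leq_card_setU _ _); apply/subset_leq_card/subsetP=> v.
by rewrite !inE; case: (v \in U); case: (v \in B); rewrite ?andbF ?orbT ?orbF.
Qed.

(** [B] has at least [t * #|B|] neighbours but at most half as many in [S :\: U]. The rest lie in
    [U] or [nbhd S], whose sizes are at most [a * n / 4096] and [a * n / 64]; compare with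
    [a * n <= 2 * (k * t)]. *)
Lemma core_barrier_small : barrier S U k (t / 2) B -> (8 * #|B| <= k)%N.
Proof.
case=> sB leBk leB; have := core_expand cS leBk.
have le1 : (#|nbhd B| <= #|nbhd B :&: (S :\: U)| + (#|U| + #|nbhd S|))%N.
  apply: leq_trans (leq_add (leqnn _) (leq_card_setU U (nbhd S))).
  apply: leq_trans (leq_card_setU _ _); apply/subset_leq_card/subsetP=> v Nv.
  have := subsetP (nbhd_sub (subset_trans sB (subsetDl _ _))) v Nv.
  rewrite !in_setU !in_setI in_setD Nv.
  by case: (v \in S); case: (v \in U); rewrite //= ?orbT.
move: le1; rewrite -(ler_nat R) !natrD => le1 le2.
have := core_nbhd cS; have := core_k2 cS; rewrite -/n => le3 le4.
have le5 : 4096 * #|U|%:R <= a * n := le_trans leU a2_le.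
rewrite -(ler_nat R) natrM -(ler_pM2r (_ : 0 < t)); last by have := t_gt0; lra.
have -> : 8%:R * #|B|%:R * t = 8 * (t * #|B|%:R) by rewrite mulrAC -mulrA.
have : t / 2 * #|B|%:R = t * #|B|%:R / 2 by rewrite mulrAC.
have := an_gt0; lra.
Qed.

Lemma core_barrier_lt : barrier S U k (t / 2) B -> (#|B| < k)%N.
Proof.
move=> /core_barrier_small leB; case: (posnP #|B|) => [->|B0]; first exact: k_gt0.
by apply: leq_trans leB; rewrite ltn_Pmull.
Qed.

Lemma core_rest_neq0 : barrier S U k (t / 2) B -> A != set0.
Proof.
move=> bB; have := core_barrier_small bB; rewrite -(ler_nat R) natrM => leB.
have := card_core_split setT; rewrite !setTI -(ler_nat R) !natrD.
have := core_large cS; rewrite -/n => le1 le2.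
rewrite -card_gt0 -(ltr_nat R); have := leU; rewrite -/n.
have := k_le; have := a2_le; have := an_gt0; lra.
Qed.

(** Otherwise a subset of [W] of size [k - #|B|], at least [7 * k / 8], has all its neighbours in
    [U], [B] or [nbhd S], which together are far smaller than the expansion demands. *)
Lemma core_branch_reach (W : {set G}) : barrier S U k (t / 2) B ->
  W \subset U -> (k < #|B| + #|W|)%N -> nbhd W :&: A != set0.
Proof.
move=> bB sWU ltk; have leB := core_barrier_small bB.
have [|W' sW' cW'] := @exists_subset_card _ W (k - #|B|).
  by rewrite leq_subLR ltnW.
apply/eqP=> NW; have := core_expand cS (X := W'); rewrite cW' => /(_ (leq_subr _ _)).
have le1 : (#|nbhd W'| <= (#|U| + #|B|) + #|nbhd S|)%N.
  apply: leq_trans (leq_add (leq_card_setU U B) (leqnn _)).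
  apply: leq_trans (leq_card_setU _ _); apply/subset_leq_card/subsetP=> v Nv.
  have := subsetP (nbhd_sub sW') v Nv; rewrite in_setU.
  case/orP=> [/(subsetP sWU) Uv|NWv]; first by rewrite !in_setU Uv.
  have := subsetP (nbhd_sub (subset_trans sWU sUS)) v NWv.
  have := in_set0 v; rewrite -NW in_setI NWv !in_setU !in_setD /=.
  by case: (v \in U); case: (v \in B) => //= ->.
rewrite natrB; last by case: bB.
move: le1 leB; rewrite -!(ler_nat R) natrM !natrD => le1 leB le2.
have := core_nbhd cS; have := core_k2 cS; have := core_k cS; rewrite -/n => le3 le4 le5.
have le6 : 8 * (t * #|B|%:R) <= k%:R * t.
  by rewrite mulrCA [leRHS]mulrC ler_wpM2l //; have := t_gt0; lra.
move: le2 k_le leU; rewrite -/n mulrBr [t * k%:R]mulrC => le2 k_le' leU'.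
have := a2_le; have := an_gt0; lra.
Qed.

(** If [X] fits under the capacity, maximality of the barrier applies to it. If not, it applies to a
    subset of size [k - #|B|], nonempty by [core_barrier_lt], whose growth by [t / 2] already
    exceeds [a * n / 8]. *)
Lemma core_small_growth (X : {set G}) : maximal_barrier S U k (t / 2) B ->
  X \subset A -> X != set0 ->
  Num.min (t / 2 * #|X|%:R) (a * n / 8) <= #|X :|: nbhd X :&: A|%:R.
Proof.
move=> [bB maxB] sXA X0; have leB := core_barrier_small bB; rewrite ge_min.
have [le|lt] := leqP (#|B| + #|X|) k.
  apply/orP; left; apply: le_trans (ltW (maxB X sXA X0 le)) _.
  by rewrite ler_nat subset_leq_card // subsetUr.
have [|Y sYX cY] := @exists_subset_card _ X (k - #|B|).
  by rewrite leq_subLR ltnW.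
have := maxB Y (subset_trans sYX sXA); rewrite -card_gt0 cY.
rewrite subn_gt0 subnKC; last by case: bB.
move=> /(_ (core_barrier_lt bB) (leqnn k)).
have le1 : (#|nbhd Y :&: A| <= #|X :|: nbhd X :&: A|)%N.
  apply/subset_leq_card/subsetP=> v /setIP[Nv Av].
  by have := subsetP (nbhd_sub sYX) v Nv; rewrite !in_setU in_setI Av andbT.
rewrite natrB; last by case: bB.
move: le1 leB; rewrite -!(ler_nat R) natrM => le1 leB le2; apply/orP; right.
have := core_k2 cS; rewrite -/n => le4.
have le6 : 8 * (t * #|B|%:R) <= k%:R * t.
  by rewrite mulrCA [leRHS]mulrC ler_wpM2l //; have := t_gt0; lra.
have le7 : t / 2 * (k%:R - #|B|%:R) = k%:R * t / 2 - t * #|B|%:R / 2.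
  by rewrite mulrBr mulrAC [t * k%:R]mulrC [X in _ - X]mulrAC.
have := an_gt0; lra.
Qed.

Lemma core_medium_growth (X : {set G}) : barrier S U k (t / 2) B ->
  X \subset A -> a * n / 8 <= #|X|%:R -> (#|X|.*2 <= #|S|)%N ->
  a ^+ 2 * n / 4096 <= #|nbhd X :&: A|%:R.
Proof.
move=> bB sXA leX leXS; have := core_barrier_small bB; rewrite -(ler_nat R) natrM => leB.
have sXS : X \subset S.
  by apply: subset_trans sXA _; apply: subset_trans (subsetDl _ _) (subsetDl _ _).
have := core_cut cS sXS; rewrite -/n => /(_ _ leXS) le1.
have {}le1 := le1 ltac:(lra).
(* In units of [a ^+ 2 * n / 4096] the cut provides 4, while [U] removes at most 1 and [B] at most
   2. *)
have := card_core_split (nbhd X); rewrite -(ler_nat R) !natrD.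
move: leU k_le; rewrite -/n; lra.
Qed.

Lemma core_route (i j : nat) : maximal_barrier S U k (t / 2) B ->
  a * n / 8 <= (t / 2) ^+ i -> 4096 <= a ^+ 2 * j%:R ->
  {in A &, forall x y, exists P : {set G},
     [/\ induces_connected P, P \subset A, x \in P, y \in P &
         (#|P| <= (i + j).+1.*2)%N]}.
Proof.
move=> mB lei lej.
have sAS : A \subset S by apply: subset_trans (subsetDl _ _) (subsetDl _ _).
have bl x : x \in A -> (#|S| < #|ball A x (i + j)|.*2)%N.
  move=> Ax; apply: (@ball_large _ _ _ _ (t / 2) (a * n / 8) (a ^+ 2 * n / 4096)) => //.
  - have := t_gt0; lra.
  - apply: le_trans (_ : n <= _); first by rewrite ler_nat max_card.
    have := ler_wpM2r (ltW (core_n cS)) lej; rewrite -/n; lra.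
  - move=> X sX X0; exact: (core_small_growth mB).
  - by move=> X sX leX leXS; apply: core_medium_growth => //; case: mB.
by move=> x y Ax Ay; apply: (ball_join sAS) => //; apply: bl.
Qed.

End Core.

(** * Choice of parameters and conclusion *)

Lemma core_of_expander (R : realType) (G : sgraph) (a t : R) :
  expander a t G -> 256 <= a * t -> t <= a * #|G|%:R ->
  exists (k : nat) (S : {set G}), expander_core a t k S.
Proof.
case=> /andP[a0 a1] t1 exG le256 leta.
have t0 : 0 < t by lra.
have n0 : 0 < #|G|%:R :> R by rewrite -(pmulr_rgt0 _ a0); lra.
have an0 : 0 < a * #|G|%:R by rewrite mulr_gt0.
(* With [eta = a / 64] and [#|S|] at least [a * n / 8], the cut bound becomes
   [a ^+ 2 * n / 1024]. *)
have [||S [leS leN cut]] := @exists_core R G (a / 64) (a * #|G|%:R / 8).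
- lra.
- have : a * #|G|%:R < #|G|%:R by rewrite gtr_pMl.
  lra.
pose q := a * #|G|%:R / t; pose k := Num.trunc q.
(* Here [t <= a * n] enters: it makes [k] at least 1, so that rounding [q] down loses at most a
   factor 2. *)
have q1 : 1 <= q by rewrite ler_pdivlMr // mul1r.
have /andP[kq qk] : k%:R <= q < k.+1%:R by apply: truncn_itv; lra.
have k1 : 1 <= k%:R :> R by rewrite ler1n truncn_gt0.
have qt : q * t = a * #|G|%:R by rewrite /q divfK // gt_eqF.
exists k, S; split=> //.
- by rewrite -qt ler_wpM2r // ltW.
- rewrite -qt mulrA ler_wpM2r ?(ltW t0) //; move: qk; rewrite -natr1; lra.
- by move=> X leX; apply: exG; apply: le_trans kq; rewrite ler_nat.
- lra.
- lra.
- move=> X sX leX leXS; have := cut X sX _ leXS.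
  have le8 : a * (a * #|G|%:R) <= a * (8 * #|S|%:R) by rewrite ler_wpM2l ?(ltW a0) //; lra.
  rewrite expr2 -mulrA => h; have {h} := h ltac:(lra); lra.
Qed.

Lemma exists_radius (R : realType) (n t : R) : 4 <= t -> t <= n ->
  exists2 i : nat, i%:R <= 3 * (ln n / ln t) & n <= (t / 2) ^+ i.
Proof.
move=> t4 tn; have t2 : 0 < t / 2 by lra.
have lnt : 0 < ln t by apply: ln_gt0; lra.
have lntn : ln t <= ln n by rewrite ler_ln ?posrE //; lra.
set q := ln n / ln t; have q1 : 1 <= q by rewrite ler_pdivlMr // mul1r.
have qt : q * ln t = ln n by rewrite /q divfK // gt_eqF.
have : 0 <= 2 * q by lra.
clearbody q => /truncn_itv; set i := Num.trunc _; clearbody i => /andP[leq ltq].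
exists i.+1; first by rewrite -natr1; lra.
rewrite -ler_ln ?posrE ?exprn_gt0 //; last by lra.
rewrite lnXn // -[leRHS]mulr_natl.
(* For [t >= 4], [t / 2] is at least the square root of [t], so [2 * q] steps suffice; rounding up
   stays within [3 * q] because [q >= 1]. *)
have ln2 : ln t <= 2 * ln (t / 2).
  rewrite mulr_natl -lnXn // ler_ln ?posrE ?exprn_gt0 //; last by lra.
  by rewrite expr2; nra.
have := ler_wpM2l (ler0n R i.+1) ln2; have := ler_wpM2r (ltW lnt) (ltW ltq).
rewrite -mulrA qt; lra.
Qed.

(** Here [x] and [y] count vertices and edges of [H], and [q] is the ratio of logarithms. A route
    costs at most [(2 * j + 8) * q]; two routes per edge give [4 * j + 16], and the vertices add
    1. *)
Lemma model_size_le (R : realFieldType) (i j q m x y : R) :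
  1 <= q -> 0 <= i -> i <= 3 * q -> 0 <= j -> x <= m -> 0 <= y -> y <= m ->
  x + 2 * y * (2 * (i + j + 1)) <= m * q * (4 * j + 17).
Proof.
move=> q1 i0 iq j0 xm y0 ym; have m0 : 0 <= m by apply: le_trans ym.
have l1 : 2 * (i + j + 1) <= (2 * j + 8) * q by have := ler_wpM2l j0 q1; lra.
have l2 : y * (2 * (i + j + 1)) <= m * ((2 * j + 8) * q) by apply: ler_pM => //; lra.
have l3 : m <= m * q by rewrite ler_peMr.
lra.
Qed.

(* The hypothesis t <= alpha * n says that the size bound alpha * n / t of the
   expansion condition is at least 1. Without it that condition concerns only
   the empty set, so an edgeless graph would be a counterexample. *)
Theorem theorem1p4 (R : realType) (alpha : R) (halpha : 0 < alpha < 1) :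
  exists (xi : R) (n0 t0 : nat), 0 < xi /\
    forall (G : sgraph) (t : R),
      (n0 <= #|G|)%N -> t0%:R <= t -> t <= alpha * #|G|%:R ->
      expander alpha t G ->
      minor_universal (xi * #|G|%:R * (ln t / ln #|G|%:R)) G.
Proof.
have /andP[a0 a1] := halpha.
have a20 : 0 < alpha ^+ 2 by rewrite exprn_gt0.
(* The number [j] of steps in the linear growth phase depends on [alpha] only. *)
have [j aj] : exists j : nat, 4096 <= alpha ^+ 2 * j%:R.
  exists (Num.trunc (4096 / alpha ^+ 2)).+1.
  by rewrite mulrC -ler_pdivrMr //; apply/ltW/truncnS_gt.
have M0 : 0 < 4 * j%:R + 17 :> R by rewrite ltr_wpDl ?mulr_ge0.
(* [xi] makes the bound of [model_size_le] equal to the allowance [alpha ^+ 2 * n / 4096] for the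
   used set. The threshold on [t] gives [alpha * t >= 256]; with [t <= alpha * n] this already
   forces [n] to be large, so [n0] can be 0. *)
exists (alpha ^+ 2 / 4096 / (4 * j%:R + 17)), 0%N, (Num.trunc (256 / alpha)).+1.
split=> [|G t _ t0 leta exG H]; first by rewrite !divr_gt0.
have a256 : 256 <= alpha * t.
  rewrite mulrC -ler_pdivrMr //; apply: ltW; apply: lt_le_trans t0.
  exact: truncnS_gt.
have t256 : 256 <= t.
  have t_gt0 : 0 < t by rewrite -(pmulr_rgt0 _ a0); apply: lt_le_trans a256.
  by apply: le_trans a256 _; rewrite ler_piMl // ltW.
have t4 : 4 <= t by apply: le_trans t256; rewrite ler_nat.
have t2 : 0 <= t / 2 by rewrite divr_ge0 // (le_trans _ t4).
have [k [S cS]] := core_of_expander exG a256 leta.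
have n0 : 0 < #|G|%:R :> R := core_n cS.
have tn : t <= #|G|%:R by apply: le_trans leta _; rewrite ler_piMl // ltW.
have [i iq lei] := exists_radius t4 tn.
have lnt : 0 < ln t by apply: ln_gt0; apply: lt_le_trans t4; rewrite ltr1n.
have q1 : 1 <= ln #|G|%:R / ln t.
  by rewrite ler_pdivlMr // mul1r ler_ln ?posrE // (lt_le_trans _ t4).
rewrite -[ln t / _]invf_div; set q := ln _ / ln t in iq q1 *.
set m := _ / q => leH leE.
have mq : m * q * (4 * j%:R + 17) = alpha ^+ 2 / 4096 * #|G|%:R.
  have q0 : q != 0 by rewrite gt_eqF // (lt_le_trans _ q1).
  by rewrite /m divfK // mulrAC divfK // gt_eqF.
have budget (U : {set G}) :
    (#|U| <= #|H| + #|edges H|.*2 * (i + j).+1.*2)%N ->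
    4096 * #|U|%:R <= alpha ^+ 2 * #|G|%:R.
  have lE : ((i + j).+1.*2)%:R = 2 * (i%:R + j%:R + 1) :> R.
    by rewrite -mul2n natrM -[(i + j).+1]addn1 !natrD.
  have eE : (#|edges H|.*2)%:R = 2 * #|edges H|%:R :> R by rewrite -mul2n natrM.
  rewrite -(ler_nat R) natrD natrM lE eE => leU.
  have := le_trans leU (model_size_le q1 (ler0n _ i) iq (ler0n _ j) leH (ler0n _ _) leE).
  by rewrite mq mulrAC ler_pdivlMr // mulrC.
have lei' : alpha * #|G|%:R / 8 <= (t / 2) ^+ i.
  apply: le_trans lei; rewrite ler_pdivrMr //.
  apply: le_trans (_ : #|G|%:R <= _); first by rewrite ler_piMl // ltW.
  by rewrite ler_peMr // ler1n.
apply: (@minor_of_core R G H S k (i + j).+1.*2 (t / 2)) => //.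
- move=> U B sUS /budget leU mB; split.
    by apply: (core_rest_neq0 cS leU); case: mB.
  exact: (core_route cS).
- move=> U B W sUS /budget leU bB; exact: (core_branch_reach cS).
Qed.
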